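(* For every integer $N\geq 2$, let $$\Theta_2(N) = \frac{1}{16}\,2^{2N}\prod_{i=1}^{2}\frac{2^{N-2+i}-1}{2^i-1}\prod_{i=1}^{2}\left(2^{N+1-i}+1\right).$$ Then $\Theta_2(N)$ is the number of those planes $\mathrm{PG}(2,2)$ of $\mathrm{PG}(2N-1,2)$ that contain exactly three totally isotropic lines $\mathrm{PG}(1,2)$, and the number $D_l(N)$ of linear doilies in $\mathcal{W}(2N-1,2)$ is $$D_l(N) = \frac{4}{15}\,4^{N-3}\,\Theta_2(N).$$
   Context: $\mathrm{PG}(d,2)$ is the projective space of $\mathbb{F}_2^{d+1}$; its points are the nonzero vectors and its lines the triples $\{a,b,a+b\}$. $\mathcal{W}(2N-1,2)$ is the symplectic polar space whose points are all points of $\mathrm{PG}(2N-1,2)$ (nonzero vectors of $\mathbb{F}_2^{2N}$) and whose subspaces are those totally isotropic for the symplectic form $\sigma(x,y)=\sum_{j=1}^N (x_j y_{N+j}+x_{N+j}y_j)$. Its lines are the totally isotropic lines, i.e. the triples $\{a,b,a+b\}$ with $a\neq b$ nonzero and $\sigma(a,b)=0$. The doily is the unique generalized quadrangle $\mathrm{GQ}(2,2)$ (15 points, 15 lines, 3 points per line, 3 lines per point, and for each point $p$ not on a line $L$ there is a unique point of $L$ collinear with $p$). A doily in $\mathcal{W}(2N-1,2)$ (an $N$-qubit doily) is a set of 15 points of $\mathcal{W}(2N-1,2)$ together with 15 lines of $\mathcal{W}(2N-1,2)$ on these points, forming an incidence structure isomorphic to the doily, such that two distinct points $a,b$ of it satisfy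 $\sigma(a,b)=0$ if and only if they lie on a common line of it. A doily in $\mathcal{W}(2N-1,2)$ is called linear if its 15 points span a $\mathrm{PG}(3,2)$ (i.e. a 4-dimensional vector subspace of $\mathbb{F}_2^{2N}$). *)

(* Defs.v *)
From mathcomp Require Import all_boot all_order all_algebra.

Set Implicit Arguments.
Unset Strict Implicit.
Unset Printing Implicit Defensive.

Import GRing.Theory.
Local Open Scope ring_scope.

(* A point-line geometry on a finite type T is a pair S, with S.1 the set of
   points and S.2 the set of lines, each line being the set of its points. *)

Section Geometry.

Variable T : finType.
Implicit Type S : {set T} * {set {set T}}.

Definition collinear S (p q : T) : bool :=
  [exists l in S.2, (p \in l) && (q \in l)].

Definition is_GQ22 S : Prop :=
  [/\ {in S.2, forall l : {set T}, l \subset S.1},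
      #|S.1| = 15%N /\ #|S.2| = 15%N,
      {in S.2, forall l : {set T}, #|l| = 3%N},
      {in S.1, forall p, #|[set l in S.2 | p \in l]| = 3%N} &
      {in S.1 & S.2, forall p (l : {set T}), p \notin l ->
         #|[set q in l | collinear S p q]| = 1%N}].

End Geometry.

Definition isomorphic (T U : finType) (S : {set T} * {set {set T}})
    (S' : {set U} * {set {set U}}) : bool :=
  [exists f : {ffun T -> U},
     [&& [forall p in S.1, forall q in S.1, (f p == f q) ==> (p == q)],
         f @: S.1 == S'.1 &
         [set f @: (l : {set T}) | l in S.2] == S'.2]].

(* The usual model of GQ(2,2): the points are the 15 duads (2-subsets) of a
   6-set, the lines are the 15 synthemes (partitions of the 6-set into three
   duads).  [doily_GQ22] below checks the axioms. *)
Definition duads : {set {set 'I_6}} := [set d : {set 'I_6} | #|d| == 2%N].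

Definition synthemes : {set {set {set 'I_6}}} :=
  [set s : {set {set 'I_6}} | partition s [set: 'I_6] && (s \subset duads)].

Definition doily : {set {set 'I_6}} * {set {set {set 'I_6}}} :=
  (duads, synthemes).

Lemma duadE (d : {set 'I_6}) : (d \in duads) = (#|d| == 2%N).
Proof. by rewrite inE. Qed.

Lemma syntheme_card (s : {set {set 'I_6}}) : s \in synthemes -> #|s| = 3%N.
Proof.
rewrite inE => /andP[sP /subsetP sD].
have H : {in s, forall A : {set 'I_6}, #|A| = 2%N}.
  by move=> A /sD; rewrite duadE => /eqP.
have := card_uniform_partition H sP.
by rewrite cardsT card_ord; case: #|s| => [|[|[|[|n]]]].
Qed.

Lemma syntheme_disjoint (s : {set {set 'I_6}}) (d e : {set 'I_6}) :
  s \in synthemes -> d \in s -> e \in s -> d != e -> [disjoint d & e].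
Proof.
by rewrite inE => /andP[/and3P[_ /trivIsetP tI _] _] ds es; apply: tI.
Qed.

Lemma card_duadU (d e : {set 'I_6}) : d \in duads -> e \in duads ->
  [disjoint d & e] -> #|~: (d :|: e)| = 2%N.
Proof.
rewrite !duadE => /eqP d2 /eqP e2 /disjoint_setI0 de.
have := cardsC (d :|: e); rewrite card_ord cardsU de cards0 d2 e2 subn0.
by case: #|_| => [|[|[|n]]].
Qed.

Lemma syntheme_of2 (d e : {set 'I_6}) : d \in duads -> e \in duads ->
  [disjoint d & e] -> [set d; e; ~: (d :|: e)] \in synthemes.
Proof.
move=> dD eD de; have c2 := card_duadU dD eD de.
move: (dD) (eD); rewrite !duadE => /eqP d2 /eqP e2.
rewrite inE; apply/andP; split; last first.
  by apply/subsetP => x; rewrite !inE -orbA => /or3P[] /eqP->;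
     rewrite ?d2 ?e2 ?c2.
apply/and3P; split.
- rewrite eqEsubset subsetT /=; apply/subsetP => x _; apply/bigcupP.
  case xd : (x \in d); first by exists d => //; rewrite !inE eqxx.
  case xe : (x \in e); first by exists e => //; rewrite !inE eqxx orbT.
  by exists (~: (d :|: e)); rewrite !inE ?eqxx ?orbT // xd xe.
- have dc : [disjoint d & ~: (d :|: e)].
    by rewrite -setI_eq0; apply/eqP/setP => x; rewrite !inE; case: (x \in d).
  have ec : [disjoint e & ~: (d :|: e)].
    by rewrite -setI_eq0; apply/eqP/setP => x; rewrite !inE;
       case: (x \in e); rewrite ?orbT.
  apply/trivIsetP => A B; rewrite !inE -!orbA.
  by move=> /or3P[] /eqP-> /or3P[] /eqP-> //;
     rewrite ?eqxx // => _; rewrite disjoint_sym.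
- by rewrite !inE -!orbA; apply/negP => /or3P[] /eqP h;
     move: d2 e2 c2; rewrite -?h cards0.
Qed.

Lemma synthemeE (s : {set {set 'I_6}}) (d e : {set 'I_6}) :
  s \in synthemes -> d \in s -> e \in s -> d != e ->
  s = [set d; e; ~: (d :|: e)].
Proof.
move=> sS ds es dNe.
have s3 := syntheme_card sS.
have de := syntheme_disjoint sS ds es dNe.
have sD x : x \in s -> x \in duads.
  by move: sS; rewrite inE => /andP[_ /subsetP]; apply.
have c2 := card_duadU (sD _ ds) (sD _ es) de.
have : #|s :\ d :\ e| == 1%N.
  move: s3; rewrite (cardsD1 d) ds (cardsD1 e) !inE es eq_sym dNe /=.
  by rewrite !add1n => -[->].
case/cards1P => c sc.
have /setD1P[cNe /setD1P[cNd cs]] : c \in s :\ d :\ e by rewrite sc set11.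
have -> : ~: (d :|: e) = c.
  apply/esym/eqP; rewrite eqEcard c2; apply/andP; split; last first.
    by have := sD _ cs; rewrite duadE => /eqP->.
  rewrite setCU subsetI -!disjoints_subset.
  by rewrite !(syntheme_disjoint sS).
rewrite -(setD1K ds) -(setD1K (_ : e \in s :\ d)) ?sc ?setUA //.
by rewrite !inE es eq_sym dNe.
Qed.

Lemma duad_synthemes (d : {set 'I_6}) : d \in duads ->
  #|[set s in synthemes | d \in s]| = 3%N.
Proof.
move=> dD; have /eqP d2 : #|d| == 2%N by rewrite -duadE.
have R4 : #|~: d| = 4%N.
  by have := cardsC d; rewrite d2 card_ord !addSn => -[].
have /card_gt0P[k kR] : (0 < #|~: d|)%N by rewrite R4.
have kNd : k \notin d by rewrite inE in kR.
pose F (j : 'I_6) := [set d; [set k; j]; ~: (d :|: [set k; j])].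
have -> : [set s in synthemes | d \in s] = F @: (~: d :\ k).
  apply/setP => s; rewrite inE; apply/andP/imsetP => [[sS ds]|[j]].
    move: (sS); rewrite inE => /andP[/and3P[/eqP cs tI _] /subsetP sD].
    have kc : k \in cover s by rewrite cs.
    have kB : k \in pblock s k by rewrite mem_pblock.
    have Bs : pblock s k \in s by rewrite pblock_mem.
    have dNB : d != pblock s k by apply: contraNneq kNd => {1}->.
    have : #|pblock s k :\ k| == 1%N.
      have := sD _ Bs; rewrite duadE => /eqP.
      by rewrite (cardsD1 k) kB add1n => -[->].
    case/cards1P => j Bj.
    have BE : pblock s k = [set k; j] by rewrite -(setD1K kB) Bj.
    exists j; last by rewrite /F -BE; apply: synthemeE.
    have /setD1P[jNk jB] : j \in pblock s k :\ k by rewrite Bj set11.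
    rewrite !inE jNk /=; apply: contraL jB => jd.
    by rewrite (disjointFr (syntheme_disjoint sS ds Bs dNB) jd).
  case/setD1P=> jNk; rewrite inE => jNd ->.
  split; last by rewrite !inE eqxx.
  rewrite /F; apply: syntheme_of2 => //.
    by rewrite duadE cards2 [k == j]eq_sym jNk.
  rewrite -setI_eq0; apply/eqP/setP => x; rewrite !inE.
  apply/negP => /andP[xd /orP[] /eqP xE]; move: xd; rewrite xE.
    exact/negP.
  exact/negP.
rewrite card_in_imset.
  by move: R4; rewrite (cardsD1 k) kR add1n => -[].
move=> i j; rewrite !inE => /andP[iNk iNd] /andP[jNk jNd] FE.
have : [set k; j] \in F i by rewrite FE !inE eqxx orbT.
rewrite !inE -orbA => /or3P[] /eqP/setP E.
- by move: (E k) kNd; rewrite !inE eqxx => <-.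
- by move: (E j); rewrite !inE eqxx orbT (negPf jNk) => /esym/eqP.
- by move: (E k); rewrite !inE eqxx orbT.
Qed.

Lemma doily_GQ22 : is_GQ22 doily.
Proof.
have c15 : #|duads| = 15%N.
  rewrite -[15%N]/('C(6, 2)) -[in RHS](card_ord 6) -card_draws.
  by rewrite -cardsE; apply: eq_card => x; rewrite !inE.
have sub s : s \in synthemes -> s \subset duads.
  by rewrite inE => /andP[].
split => //=.
- split => //; apply/eqP; rewrite -(eqn_pmul2r (isT : (0 < 3)%N)).
  rewrite -sum_nat_const -[X in _ == (X * _)%N]c15 -sum_nat_const.
  have E1 : (\sum_(s in synthemes) 3 =
             \sum_(s in synthemes) \sum_(d in duads) (d \in s))%N.
    apply: eq_bigr => s sS.
    transitivity #|s|; first by rewrite (syntheme_card sS).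
    rewrite -sum1_card.
    rewrite [RHS](bigID (mem s)) /= [X in (_ + X)%N]big1 ?addn0.
      apply: eq_big => d; last by move=> ->.
      by case ds : (d \in s); rewrite ?andbF // (subsetP (sub _ sS)).
    by move=> d /andP[_ /negPf->].
  rewrite E1 exchange_big /=; apply/eqP/eq_bigr => d dD.
  transitivity #|[set s in synthemes | d \in s]|; last exact: duad_synthemes.
  rewrite -sum1_card big_mkcond [RHS]big_mkcond /=.
  apply: eq_bigr => s _; rewrite [s \in [set _ in _ | _]]in_set.
  by case: (s \in synthemes); case: (d \in s).
- exact: syntheme_card.
- exact: duad_synthemes.
move=> p l pD lS pNl.
have coll q : q \in l -> collinear doily p q = [disjoint p & q].
  move=> ql; have qD := subsetP (sub _ lS) _ ql.
  have pNq : p != q by apply: contraNneq pNl => ->.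
  apply/existsP/idP => [[s /and3P[sS ps qs]]|pq].
    exact: syntheme_disjoint sS ps qs pNq.
  exists [set p; q; ~: (p :|: q)].
  by rewrite syntheme_of2 // !inE !eqxx orbT.
move: (lS); rewrite inE => /andP[/and3P[/eqP cl tI _] _].
have pb x : pblock l x \in l by rewrite pblock_mem // cl.
have xpb x : x \in pblock l x by rewrite mem_pblock cl.
have : #|p| == 2%N by rewrite -duadE.
case/cards2P => i [j [ij pE]].
have card_pb x : #|pblock l x| = 2%N.
  by apply/eqP; rewrite -duadE (subsetP (sub _ lS)).
have Bij : pblock l i != pblock l j.
  apply: contraNneq pNl => E.
  suff -> : p = pblock l i by [].
  apply/eqP; rewrite eqEcard card_pb pE cards2 ij andbT.
  by apply/subsetP => x; rewrite !inE => /orP[] /eqP->; rewrite ?xpb // E xpb.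
apply/eqP/cards1P; exists (~: (pblock l i :|: pblock l j)).
have lE := synthemeE lS (pb i) (pb j) Bij.
apply/setP => q; rewrite !inE; apply/andP/eqP => [[ql]|qE].
  rewrite coll // => pq.
  move: (ql); rewrite {1}lE !inE -orbA => /or3P[] /eqP // qE.
    have ip : i \in p by rewrite pE !inE eqxx.
    by have := disjointFr pq ip; rewrite qE xpb.
  have jp : j \in p by rewrite pE !inE eqxx orbT.
  by have := disjointFr pq jp; rewrite qE xpb.
have ql : q \in l by rewrite qE {3}lE inE set11 orbT.
split => //; rewrite coll //.
rewrite -setI_eq0; apply/eqP/setP => x; rewrite pE qE !inE.
by apply/negP => /andP[/orP[] /eqP->]; rewrite xpb ?orbT.
Qed.

(* 'rV['F_2]_(N + N): the coordinates x_1, ..., x_N and x_{N+1}, ..., x_{2N}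
   are the entries at [lshift N j] and [rshift N j], for j < N. *)
Definition symp (N : nat) (x y : 'rV['F_2]_(N + N)) : 'F_2 :=
  \sum_(j < N) (x 0 (lshift N j) * y 0 (rshift N j)
                + x 0 (rshift N j) * y 0 (lshift N j)).

Definition pg_points (N : nat) : {set 'rV['F_2]_(N + N)} := [set x | x != 0].

Definition ti_lines (N : nat) : {set {set 'rV['F_2]_(N + N)}} :=
  [set [set p.1; p.2; p.1 + p.2] |
     p : 'rV['F_2]_(N + N) * 'rV['F_2]_(N + N) &
       [&& p.1 != 0, p.2 != 0, p.1 != p.2 & symp p.1 p.2 == 0]].

(* A plane is given by its points: the nonzero vectors of a 3-dimensional
   subspace.  The subspace is recovered as the span of its points. *)
Definition pg_planes (N : nat) : {set {set 'rV['F_2]_(N + N)}} :=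
  [set A : {set 'rV['F_2]_(N + N)} |
     (\dim <<enum A>>%VS == 3%N) &&
     (A == [set x in pg_points N | x \in <<enum A>>%VS])].

Definition qubit_doilies (N : nat) :
    {set {set 'rV['F_2]_(N + N)} * {set {set 'rV['F_2]_(N + N)}}} :=
  [set D : {set 'rV['F_2]_(N + N)} * {set {set 'rV['F_2]_(N + N)}} |
     [&& D.1 \subset pg_points N, #|D.1| == 15%N,
         D.2 \subset ti_lines N, #|D.2| == 15%N,
         isomorphic doily D &
         [forall a in D.1, forall b in D.1,
            (a != b) ==> ((symp a b == 0) == collinear D a b)]]].

Definition linear_doilies (N : nat) :
    {set {set 'rV['F_2]_(N + N)} * {set {set 'rV['F_2]_(N + N)}}} :=
  [set D in qubit_doilies N | \dim <<enum D.1>>%VS == 4%N].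

(* For N >= 2 the truncated subtractions below do not truncate. *)
Definition Theta2 (N : nat) : rat :=
  1 / 16 * 2 ^+ (2 * N)
  * (\prod_(1 <= i < 3) ((2 ^+ (N - 2 + i) - 1) / (2 ^+ i - 1)))
  * (\prod_(1 <= i < 3) (2 ^+ (N + 1 - i) + 1)).

(* Main.v *)
(* Over F_2, a subspace U with radical R contains (|U| - |R|) |U| / 2 ordered
   pairs with product 1, and splitting off such a pair divides |U| by 4 without
   changing R.  Applied to the whole space, this counts the triples formed by a
   hyperbolic pair and a nonzero vector orthogonal to it, and the pairs of
   orthogonal hyperbolic pairs.  Applied to a 3-space with |R| = 2, resp. to a
   nondegenerate 4-space, it shows that 24 triples, resp. 720 quadruples, span
   a given one.  The pair count also gives the number of totally isotropic lines
   in U, so that a plane has exactly three of them iff |R| = 2, and a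
   nondegenerate 4-space has 15, which must then be the lines of the doily. *)

Require Import Defs.
From mathcomp Require Import all_boot all_order all_algebra all_field.
From mathcomp Require Import ring lra zify.

Set Implicit Arguments.
Unset Strict Implicit.
Unset Printing Implicit Defensive.

Import GRing.Theory.
Local Open Scope ring_scope.

(** * Double counting and arithmetic in F_2 *)

Lemma card_fibres (T S : finType) (h : T -> S) (A : {set T}) (B : {set S}) k :
    {in A, forall t, h t \in B} ->
    {in B, forall b, #|[set t in A | h t == b]| = k} ->
  #|A| = (#|B| * k)%N.
Proof.
move=> hAB hk; rewrite -sum1_card (partition_big h (mem B)) //=.
rewrite -sum_nat_const; apply: eq_bigr => b bB.
by rewrite -(hk b bB) -sum1_card; apply: eq_bigl => t; rewrite inE.
Qed.

Lemma card_sum_pairs (S T : finType) (A : {set S}) (B : S -> {set T}) :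
  #|[set p : S * T | (p.1 \in A) && (p.2 \in B p.1)]| = (\sum_(x in A) #|B x|)%N.
Proof.
under [RHS]eq_bigr do rewrite -sum1_card.
rewrite pair_big_dep /= -sum1_card; apply: eq_bigl => p; by rewrite inE.
Qed.

Lemma F2_eq1 (c : 'F_2) : (c == 1) = (c != 0).
Proof. by case: c => [[|[|n]] //]. Qed.

Lemma F2_addcc (c : 'F_2) : c + c = 0.
Proof. by case: c => [[|[|n]] //] i; apply/val_inj. Qed.

(** * Symplectic counting *)

Section Symplectic.

Variable N : nat.
Local Notation V := 'rV['F_2]_(N + N).
Implicit Types (x y z : V) (U : {set V}) (W : {vspace V}).

Lemma addvv x : x + x = 0.
Proof. by apply/rowP => i; rewrite !mxE F2_addcc. Qed.

Lemma addvK x y : x + y + y = x.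
Proof. by rewrite -addrA addvv addr0. Qed.

Lemma addv_eq0 x y : (x + y == 0) = (x == y).
Proof. by rewrite -(inj_eq (addIr y)) addvK add0r. Qed.

Lemma sympC x y : symp x y = symp y x.
Proof.
by apply: eq_bigr => j _; rewrite addrC; congr (_ + _); apply: mulrC.
Qed.

Lemma sympDr x y z : symp x (y + z) = symp x y + symp x z.
Proof.
rewrite -big_split; apply: eq_bigr => j _.
by rewrite !mxE !mulrDr addrACA.
Qed.

Lemma sympDl x y z : symp (y + z) x = symp y x + symp z x.
Proof. by rewrite sympC sympDr !(sympC x). Qed.

Lemma sympZr a x y : symp x (a *: y) = a * symp x y.
Proof. rewrite big_distrr; apply: eq_bigr => j _ /=.
by rewrite !mxE mulrDr; congr (_ + _); apply: mulrCA. Qed.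

Lemma sympxx x : symp x x = 0.
Proof. by apply: big1 => j _; rewrite mulrC F2_addcc. Qed.

Lemma sympx0 x : symp x 0 = 0.
Proof. by rewrite -(scale0r 0) sympZr mul0r. Qed.

Lemma symp0x x : symp 0 x = 0.
Proof. by rewrite sympC sympx0. Qed.

Lemma symp_nondeg x : x != 0 -> exists y, symp x y = 1.
Proof.
move=> x0; have [i xi] : exists i, x 0 i != 0.
  apply/existsP; apply: contra_neqT x0 => /existsPn xi.
  by apply/rowP => i; rewrite mxE; move: (xi i); rewrite negbK => /eqP.
(* The form pairs coordinate j with coordinate N + j, so the unit vector at the partner of [i] reads
   off the entry [x 0 i]. *)
exists (delta_mx 0
  (match split i with inl j => rshift N j | inr j => lshift N j end)).
move: xi; rewrite -F2_eq1 => /eqP xi.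
rewrite -[i]splitK /unsplit in xi.
case: (split i) xi => j xi.
- rewrite /symp (bigD1 j) //= big1 ?addr0 => [|k kj].
    by rewrite !mxE xi !eqxx eq_lrshift mulr0 addr0 mulr1.
  by rewrite !mxE eq_lrshift eq_rshift (negPf kj) andbF !mulr0 addr0.
- rewrite /symp (bigD1 j) //= big1 ?addr0 => [|k kj].
    by rewrite !mxE xi !eqxx eq_rlshift mulr0 add0r mulr1.
  by rewrite !mxE eq_rlshift eq_lshift (negPf kj) andbF !mulr0 addr0.
Qed.

Lemma symp_span x X v :
  {in X, forall y, symp x y = 0} -> v \in <<X>>%VS -> symp x v = 0.
Proof.
move=> xX vX; have /coord_span -> : v \in <<in_tuple X>>%VS by [].
rewrite (big_morph (symp x) (sympDr x) (sympx0 x)) big1 // => i _.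
by rewrite sympZr xX ?mulr0 // mem_nth.
Qed.

(** Over F_2 closure under addition already gives closure under scalars, so these are the subspaces,
    taken as finite sets ready for counting. *)
Definition addsub U := 0 \in U /\ {in U &, forall x y, x + y \in U}.

(** Translation by a vector of [U] whose product with [x] is 1 exchanges the two fibres of [symp x]
    on [U]. *)
Lemma card_half U x b : addsub U -> (exists2 y, y \in U & symp x y = 1) ->
  (2 * #|[set y in U | symp x y == b]|)%N = #|U|.
Proof.
move=> [_ UD] [y0 y0U xy0].
have tr : #|[set y in U | symp x y == b]| = #|[set y in U | symp x y == b + 1]|.
  rewrite -(card_imset _ (addIr y0)); congr #|pred_of_set _|.
  apply/setP => y; rewrite inE; apply/imsetP/andP => [[z]|[yU /eqP xy]].
    by rewrite inE => /andP[zU /eqP xz] ->; rewrite UD // sympDr xz xy0.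
  exists (y + y0); last by rewrite addvK.
  by rewrite inE UD //= sympDr xy xy0 -addrA F2_addcc addr0.
rewrite mul2n -addnn {2}tr -(cardsID [set y | symp x y == b] U) -setIdE.
congr (_ + _)%N; congr #|pred_of_set _|.
apply/setP => y; rewrite !inE andbC; congr andb.
by case: (symp x y) b {tr} => [[|[|n]] //] i [[|[|m]] //].
Qed.

Definition symp_rad U := [set x in U | [forall y in U, symp x y == 0]].
Definition perp U (p : V * V) :=
  [set x in U | (symp p.1 x == 0) && (symp p.2 x == 0)].
Definition hyp U :=
  [set p : V * V | [&& p.1 \in U, p.2 \in U & symp p.1 p.2 == 1]].

Lemma addsub_perp U p : addsub U -> addsub (perp U p).
Proof.
move=> [U0 UD]; split; first by rewrite inE U0 !sympx0 eqxx.
move=> x y; rewrite !inE => /and3P[xU /eqP x1 /eqP x2] /and3P[yU /eqP y1 /eqP y2].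
by rewrite UD // !sympDr x1 x2 y1 y2 !addr0 eqxx.
Qed.

(** The first member of a hyperbolic pair lies outside the radical. For each such [x], the
    functional [symp x] is nonzero on [U], so half of [U] completes the pair. *)
Lemma card_hyp U : addsub U -> (2 * #|hyp U|)%N = ((#|U| - #|symp_rad U|) * #|U|)%N.
Proof.
move=> UA.
have -> : hyp U = [set p : V * V | (p.1 \in U :\: symp_rad U) &&
                       (p.2 \in [set y in U | symp p.1 y == 1])].
  apply/setP => -[x y]; rewrite !inE /=; case xU: (x \in U); rewrite ?andbF //=.
  rewrite andbT; case yU : (y \in U); rewrite ?andbF //=.
  case xy: (symp x y == 1); rewrite ?andbF //= andbT; apply/esym/negP.
  by move=> /forall_inP/(_ y yU); rewrite (eqP xy).
rewrite (card_sum_pairs _ (fun x => [set y in U | symp x y == 1])).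
rewrite big_distrr /= -cardsDS; last first.
  by apply/subsetP => x; rewrite inE => /andP[].
rewrite -sum_nat_const; apply: eq_bigr => x.
rewrite !inE => /andP[+ xU]; rewrite xU /= => /forall_inPn[y yU xy].
by apply: card_half => //; exists y => //; apply/eqP; rewrite F2_eq1.
Qed.

Lemma hypP U e f : (e, f) \in hyp U -> [/\ e \in U, f \in U & symp e f = 1].
Proof. by rewrite inE => /and3P[? ? /eqP]. Qed.

Lemma card_perp U p : addsub U -> p \in hyp U -> (4 * #|perp U p|)%N = #|U|.
Proof.
case: p => e f UA /hypP[eU fU ef].
have UeA : addsub [set y in U | symp e y == 0].
  case: UA => U0 UD; split; first by rewrite inE U0 sympx0 eqxx.
  move=> x y; rewrite !inE => /andP[xU /eqP x1] /andP[yU /eqP y1].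
  by rewrite UD // sympDr x1 y1 addr0 eqxx.
rewrite -(card_half (x := e) 0 UA); last by exists f.
(* The second halving takes place in the part of [U] orthogonal to [e]; it contains [e] itself,
   whose product with [f] is 1. *)
rewrite -(card_half (x := f) 0 UeA); last first.
  by exists e; rewrite ?inE ?eU ?sympxx ?eqxx // sympC.
rewrite mulnA; congr (_ * #|pred_of_set _|)%N.
by apply/setP => x; rewrite !inE andbA.
Qed.

(* With p = (e, f), every element of U is congruent modulo e, f to an element of
   perp U p. *)
Lemma rad_perp U p : addsub U -> p \in hyp U -> symp_rad (perp U p) = symp_rad U.
Proof.
case: p => e f UA /hypP[eU fU ef]; have [U0 UD] := UA.
apply/setP => x; rewrite !inE /=; case xU : (x \in U) => //=.
apply/andP/forall_inP => [[/andP[/eqP ex /eqP fx] /forall_inP xP] u uU|xP].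
  pose v := u + (symp f u *: e + symp e u *: f).
  have sc (a : 'F_2) z : z \in U -> a *: z \in U.
    move=> zU; have [->|] := eqVneq a 0; first by rewrite scale0r.
    by rewrite -F2_eq1 => /eqP->; rewrite scale1r.
  have /xP : v \in perp U (e, f).
    rewrite inE UD ?UD ?sc //= !sympDr !sympZr !sympxx (sympC f e) ef.
    by rewrite !mulr0 !mulr1 add0r addr0 !F2_addcc eqxx.
  by rewrite !sympDr !sympZr !(sympC x) ex fx !mulr0 !addr0.
rewrite !(sympC _ x) !xP //; split=> //.
by apply/forall_inP => y; rewrite inE => /andP[yU _]; apply: xP.
Qed.

Lemma rad_setT : symp_rad setT = [set 0].
Proof.
apply/setP => x; rewrite !inE /=; apply/forall_inP/eqP => [xP|-> y _]; last first.
  by rewrite symp0x.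
apply/eqP; apply: contraT => /symp_nondeg[y xy].
by have := xP y (in_setT y); rewrite xy.
Qed.

Lemma addsub_setT : addsub setT.
Proof. by split => [|x y _ _]; rewrite in_setT. Qed.

(** The name comes from the 3-dimensional case, where [perp U t.1] is the radical of [U]; in larger
    spaces [t.2] is just orthogonal to the pair. *)
Definition hyp_rad U := [set t : (V * V) * V |
  (t.1 \in hyp U) && (t.2 \in perp U t.1 :\ 0)].
(** Such a quadruple is a symplectic basis of the 4-space it spans. *)
Definition hyp_hyp U := [set t : (V * V) * (V * V) |
  (t.1 \in hyp U) && (t.2 \in hyp (perp U t.1))].

Lemma card_hyp_rad U k : addsub U -> #|U| = (4 * k)%N ->
  (2 * #|hyp_rad U| = (#|U| - #|symp_rad U|) * #|U| * (k - 1))%N.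
Proof.
move=> UA Uk; rewrite -card_hyp // -mulnA; congr (2 * _)%N.
rewrite (card_sum_pairs _ (fun p => perp U p :\ 0)) -sum_nat_const.
apply: eq_bigr => p pU.
have <- : #|perp U p| = k.
  by apply/eqP; rewrite -(eqn_pmul2l (isT : (0 < 4)%N)) card_perp // Uk.
by rewrite (cardsD1 0 (perp U p)) (proj1 (addsub_perp p UA)) addKn.
Qed.

(** The second pair is counted by [card_hyp] inside [perp U p], which has [k] elements and, by
    [rad_perp], the radical of [U]. *)
Lemma card_hyp_hyp U k : addsub U -> #|U| = (4 * k)%N ->
  (4 * #|hyp_hyp U| = (#|U| - #|symp_rad U|) * #|U| * ((k - #|symp_rad U|) * k))%N.
Proof.
move=> UA Uk; rewrite -card_hyp // -mulnA -[4%N]/(2 * 2)%N -mulnA.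
congr (2 * _)%N; rewrite (card_sum_pairs _ (fun p => hyp (perp U p))).
rewrite big_distrr -sum_nat_const.
apply: eq_bigr => p pU /=; have pA := addsub_perp p UA.
have Pk : #|perp U p| = k.
  by apply/eqP; rewrite -(eqn_pmul2l (isT : (0 < 4)%N)) card_perp // Uk.
by rewrite card_hyp // rad_perp // Pk.
Qed.

(** * Totally isotropic lines in a subspace *)

Definition lines_in (A : {set V}) := [set l in ti_lines N | l \subset A].

Lemma ti_linesP l : l \in ti_lines N ->
  exists a b, [/\ a != 0, b != 0, a != b, symp a b = 0 & l = [set a; b; a + b]].
Proof.
by case/imsetP => -[a b]; rewrite inE => /and4P[? ? ? /eqP ?] ->; exists a, b.
Qed.

Lemma card_ti_line l : l \in ti_lines N -> #|l| = 3%N.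
Proof.
case/ti_linesP => a [b [a0 b0 ab _ ->]].
rewrite setUC cardsU1 cards2 ab !inE negb_or.
rewrite -{2}[a]addr0 -{3}[b]add0r (inj_eq (addrI a)) (inj_eq (addIr b)).
by rewrite a0 b0.
Qed.

Lemma ti_line_nz l a : l \in ti_lines N -> a \in l -> a != 0.
Proof.
case/ti_linesP => u [v [u0 v0 uv _ ->]]; rewrite !inE -orbA.
by case/or3P => /eqP->; rewrite ?addv_eq0.
Qed.

(** The three vectors of a line sum to zero and the form is alternating, so any two distinct points
    can play the part of the two generators. *)
Lemma ti_line_eq l a b : l \in ti_lines N -> a \in l -> b \in l -> a != b ->
  symp a b = 0 /\ l = [set a; b; a + b].
Proof.
move=> lL al bl ab; suff [ab0 abl] : symp a b = 0 /\ a + b \in l.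
  split=> //; apply/esym/eqP; rewrite eqEcard; apply/andP; split.
    by apply/subsetP => x; rewrite !inE -orbA => /or3P[] /eqP->.
  have /card_ti_line -> : [set a; b; a + b] \in ti_lines N.
    apply/imsetP; exists (a, b) => //.
    by rewrite inE /= (ti_line_nz lL) ?(ti_line_nz lL bl) ?ab ?ab0 ?eqxx.
  by rewrite (card_ti_line lL).
case/ti_linesP: lL al bl ab => u [v [u0 v0 uv uv0 ->]]; rewrite !inE -!orbA.
case/or3P => /eqP-> /or3P[] /eqP-> //; rewrite ?eqxx // => _.
all: rewrite ?sympDl ?sympDr ?sympxx ?(sympC v) ?uv0 ?addr0; split=> //.
all: rewrite ?[u + v + u]addrAC ?[v + (u + v)]addrCA ?[u + (u + v)]addrA.
all: rewrite ?[v + u]addrC -?addrA ?addvv ?addr0 ?add0r ?inE ?eqxx ?orbT //.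
all: by rewrite addrA addvv add0r eqxx ?orbT.
Qed.

Definition orth_pairs U := [set p : V * V |
  [&& p.1 \in U :\ 0, p.2 \in U :\ 0, p.1 != p.2 & symp p.1 p.2 == 0]].

Lemma card_orth_pairs_lines U : addsub U ->
  #|orth_pairs U| = (#|lines_in (U :\ 0%R)| * 6)%N.
Proof.
move=> [U0 UD]; apply: (@card_fibres _ _ (fun p => [set p.1; p.2; p.1 + p.2])).
  case=> a b; rewrite !inE /= => /and4P[/andP[a0 aU] /andP[b0 bU] ab ab0].
  apply/andP; split.
    by apply/imsetP; exists (a, b) => //; rewrite inE /= a0 b0 ab ab0.
  apply/subsetP => x; rewrite !inE -orbA => /or3P[] /eqP->.
  - by rewrite a0.
  - by rewrite b0.
  by rewrite addv_eq0 ab UD.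
move=> l; rewrite inE => /andP[lL /subsetP lU].
(* The ordered pairs giving [l] are the pairs of distinct points of [l]: 9 - 3 = 6 of them. *)
have -> : [set t in orth_pairs U | [set t.1; t.2; t.1 + t.2] == l] =
          setX l l :\: [set (x, x) | x in l].
  apply/setP => -[a b]; rewrite !inE /=; apply/andP/and3P.
    case=> /and4P[_ _ ab _] /eqP<-; rewrite !inE !eqxx orbT; split=> //.
    by apply: contra ab => /imsetP[x _ [-> ->]].
  case=> abl al bl; have ab : a != b.
    by apply: contra abl => /eqP->; apply/imsetP; exists b.
  have [ab0 ->] := ti_line_eq lL al bl ab.
  by move: (lU _ al) (lU _ bl); rewrite !inE => -> ->; rewrite ab ab0 !eqxx.
rewrite cardsDS; last by apply/subsetP => _ /imsetP[x xl ->]; rewrite inE xl.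
by rewrite cardsX card_imset ?(card_ti_line lL) // => x y [].
Qed.

(** Pairs (x, y) in [U] with x nonzero are of three kinds: y is 0 or x, or the product is 1, or x
    and y are distinct, nonzero and orthogonal. *)
Lemma card_orth_pairs U : addsub U ->
  (#|orth_pairs U| + (#|U| - 1) * 2 + #|hyp U| = (#|U| - 1) * #|U|)%N.
Proof.
move=> [U0 UD]; have <- : #|U :\ 0%R| = (#|U| - 1)%N by rewrite (cardsD1 0 U) U0 addKn.
have <- : (#|[set p : V * V | (p.1 \in U :\ 0%R) && (p.2 \in [set 0%R; p.1])]| =
           #|U :\ 0%R| * 2)%N.
  rewrite (card_sum_pairs _ (fun x => [set 0; x])) -sum_nat_const.
  by apply: eq_bigr => x; rewrite !inE cards2 eq_sym => /andP[->].
rewrite -cardsX -(cardsID (hyp U) (setX _ _)) addnC; congr (_ + _)%N.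
  congr #|pred_of_set _|; apply/setP => -[x y]; rewrite !inE /=.
  case: (x \in U); case: (y \in U); rewrite ?andbF //= andbT.
  by have [->|_] := eqVneq x 0; rewrite ?symp0x ?andbF.
rewrite -(cardsID (orth_pairs U) (_ :\: _)); congr (_ + _)%N; congr #|pred_of_set _|.
  apply/setP => -[x y]; rewrite !inE /= F2_eq1.
  case: (x == 0); case: (y == 0); case: (x == y); case: (symp x y == 0);
  by case: (x \in U); case: (y \in U).
apply/setP => -[x y]; rewrite !inE /= F2_eq1.
have [->|x0] := eqVneq x 0; rewrite //= ?andbF //.
have [->|y0] := eqVneq y 0; first by rewrite U0 sympx0 /= !andbF !andbT.
rewrite (eq_sym y); have [->|xy] := eqVneq x y.
  by rewrite sympxx /= !andbF !andbT andbb.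
by case: (symp x y == 0); rewrite /= ?andbF // andbT andNb.
Qed.

Lemma card_lines_in U : addsub U ->
  (12 * #|lines_in (U :\ 0%R)| + 4 * (#|U| - 1) + (#|U| - #|symp_rad U|) * #|U| =
   2 * ((#|U| - 1) * #|U|))%N.
Proof.
move=> UA; rewrite -card_hyp // -card_orth_pairs // card_orth_pairs_lines //.
by rewrite !mulnDr; congr (_ + _ + _)%N; rewrite mulnC mulnCA.
Qed.

End Symplectic.

(** * Planes *)

Section Subspaces.

Variable N : nat.
Local Notation V := 'rV['F_2]_(N + N).
Implicit Types (x y z : V) (U : {set V}) (W : {vspace V}).

(** The counting lemmas need sets containing zero, whereas planes and doilies are sets of projective
    points; [vset] and [nz] are the two views of one subspace. *)
Definition vset W : {set V} := [set x | x \in W].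
Definition nz W : {set V} := [set x in pg_points N | x \in W].

Lemma nzE W : nz W = vset W :\ 0.
Proof. by apply/setP => x; rewrite !inE. Qed.

Lemma addsub_vset W : addsub (vset W).
Proof. by split=> [|x y]; rewrite !inE ?mem0v //; apply: rpredD. Qed.

Lemma card_vset W : #|vset W| = (2 ^ \dim W)%N.
Proof.
by rewrite cardsE (@card_vspace 'F_2 V _ W) card_ord.
Qed.

Lemma span_nz W : <<enum (nz W)>>%VS = W.
Proof.
apply/eqP; rewrite eqEsubv; apply/andP; split.
  by apply/span_subvP => x; rewrite mem_enum !inE => /andP[].
apply/subvP => x xW; have [->|x0] := eqVneq x 0; first exact: mem0v.
by apply: memv_span; rewrite mem_enum !inE x0.
Qed.

Lemma nz_span_subset W (X : seq V) : {subset X <= vset W} -> size X = \dim W ->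
  free X -> nz <<X>> = nz W.
Proof.
move=> XW sX /eqP fX; congr nz; apply/eqP; rewrite eqEdim fX sX leqnn andbT.
by apply/span_subvP => x /XW; rewrite inE.
Qed.

Lemma mem_nz_span (X : seq V) : free X -> {subset X <= nz <<X>>}.
Proof. by move=> fX x xX; rewrite !inE memv_span ?(free_not0 fX). Qed.

Lemma pg_planesP A :
  reflect (exists2 W, \dim W = 3%N & A = nz W) (A \in pg_planes N).
Proof.
apply: (iffP idP) => [|[W dW ->]]; rewrite inE.
  by case/andP => /eqP dA /eqP {1}->; exists <<enum A>>%VS.
by rewrite span_nz dW !eqxx.
Qed.

(** The functional [symp f] vanishes on the span of [X] but not at [e]. This yields the linear
    independence of the triples and quadruples. *)
Lemma hyp_notin (e f : V) (X : seq V) :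
  symp f e = 1 -> {in X, forall y, symp f y = 0} -> e \notin <<X>>%VS.
Proof. by move=> fe fX; apply: contra_eqN fe => /(symp_span fX)->. Qed.

Definition seq3 (t : V * V * V) := [:: t.1.1; t.1.2; t.2].

Lemma free_seq3 U t : t \in hyp_rad U -> free (seq3 t).
Proof.
case: t => [[e f] r]; rewrite inE => /andP[/hypP[_ _ ef]] /=.
rewrite !inE => /and3P[r0 _ /= /andP[/eqP er /eqP fr]].
rewrite !free_cons nil_free span_nil memv0 r0 !andbT.
apply/andP; split; [apply: (@hyp_notin _ f) | apply: (@hyp_notin _ e)] => //.
- by rewrite sympC.
- by move=> y; rewrite !inE => /orP[] /eqP->; rewrite ?sympxx.
by move=> y; rewrite inE => /eqP->.
Qed.

(** For 8 vectors, L lines and a radical of size r, [card_lines_in] becomes 12 L = 20 + 8 r. The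
    bound r <= 8 makes the natural subtraction exact. *)
Lemma plane_lines W : \dim W = 3%N ->
  (#|lines_in (nz W)| == 3%N) = (#|symp_rad (vset W)| == 2%N).
Proof.
move=> dW; have := card_lines_in (addsub_vset W).
have : (#|symp_rad (vset W)| <= #|vset W|)%N.
  by apply: subset_leq_card; apply/subsetP => x; rewrite inE => /andP[].
by rewrite card_vset dW nzE => *; lia.
Qed.

(** Splitting off the pair leaves 8 / 4 = 2 vectors, namely 0 and [r]. The form vanishes on them, so
    they are their own radical, which is that of [W]. *)
Lemma rad_plane W t : t \in hyp_rad (vset W) -> \dim W = 3%N ->
  #|symp_rad (vset W)| = 2%N.
Proof.
case: t => p r; have WA := addsub_vset W.
rewrite inE => /andP[pW rW] dW; have PA := addsub_perp p WA.
move: (rW); rewrite !in_setD1 /= in pW *; case/andP=> r0 rP.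
have P2 : #|perp (vset W) p| = 2%N.
  by have := card_perp WA pW; rewrite card_vset dW; lia.
rewrite -(rad_perp WA pW) -[RHS]P2.
have PE : perp (vset W) p = [set 0; r].
  apply/esym/eqP; rewrite eqEcard P2 cards2 eq_sym r0 andbT.
  by apply/subsetP => x; rewrite in_set2 => /orP[] /eqP-> //; case: PA.
apply: eq_card => x; rewrite [LHS]inE; case xP: (x \in _) => //=.
apply/forall_inP => y; move: xP; rewrite PE !in_set2.
by move=> /orP[] /eqP-> /orP[] /eqP->; rewrite ?sympx0 ?symp0x ?sympxx.
Qed.

Definition planes3 := [set A in pg_planes N | #|lines_in A| == 3%N].

(** Triples are independent, so those whose span is [W] are, by dimension, exactly those with all
    entries in [W]. *)
Lemma card_planes3 : #|hyp_rad [set: V]| = (#|planes3| * 24)%N.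
Proof.
apply: (@card_fibres _ _ (fun t => nz <<seq3 t>>)) => [t tT|A].
  have ft := free_seq3 tT; have d3 : \dim <<seq3 t>> = 3%N by apply/eqP.
  rewrite inE; apply/andP; split; first by apply/pg_planesP; exists <<seq3 t>>%VS.
  rewrite plane_lines // (@rad_plane _ t) //.
  have tin x : x \in seq3 t -> x \in <<seq3 t>>%VS by apply: memv_span.
  move: tT; rewrite !inE /= => /and3P[/eqP-> -> ->].
  by rewrite !tin // !inE eqxx ?orbT.
rewrite inE => /andP[/pg_planesP[W dW ->]]; rewrite plane_lines // => /eqP r2.
have W8 : #|vset W| = (4 * 2)%N by rewrite card_vset dW.
have := card_hyp_rad (addsub_vset W) W8; rewrite W8 r2 => h24.
(* Here 2 * 24 = (8 - 2) * 8 * (2 - 1). *)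
have <- : #|hyp_rad (vset W)| = 24%N by lia.
apply: eq_card => t; rewrite [LHS]inE; apply/andP/idP => [[tT /eqP tW]|tW].
  have ft := free_seq3 tT; have tin := mem_nz_span ft.
  have tn x : x \in seq3 t -> x \in W by move/tin; rewrite tW !inE => /andP[].
  move: tT; rewrite !inE /= => /and3P[/eqP-> -> ->].
  by rewrite !tn // !inE eqxx ?orbT.
rewrite (@nz_span_subset W) ?dW ?(free_seq3 tW) //; last first.
  move: tW; rewrite !inE => /andP[/and3P[e f _] /and3P[_ r _]] x.
  by rewrite !inE => /or3P[] /eqP->.
by split=> //; move: tW; rewrite !inE => /andP[/and3P[_ _ ->] /and3P[-> _ ->]].
Qed.

End Subspaces.

(** * Doilies *)

(** Take for [x] an element of [d] outside [d'] together with an element outside both, which exists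
    because the union has at most 4 of the 6 elements. The parity of the intersection with [x] then
    tells [d] from [d'], where [d'] may be empty. *)
Lemma duad_separation (d d' : {set 'I_6}) :
    d \in duads -> ~~ (d \subset d') -> (#|d'| <= 2)%N ->
  exists x, [/\ x \in duads, #|d :&: x| = 1%N & #|d' :&: x| = 0%N].
Proof.
rewrite duadE => /eqP d2 /subsetPn[i id' iNd'] d'2.
have [k kN] : exists k, k \notin d :|: d'.
  apply/existsP; rewrite -[[exists k, _]]negbK negb_exists.
  apply/negP => /forallP dd'; have : #|d :|: d'| = 6%N.
    rewrite -[RHS](card_ord 6); apply: eq_card => k.
    by have := dd' k; rewrite negbK => ->.
  by have := cardsUI d d'; lia.
move: kN; rewrite inE negb_or => /andP[kd kd'].
have ik : i != k by apply: contraNneq kd => <-.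
exists [set i; k]; rewrite duadE cards2 ik; split=> //.
  transitivity #|[set i]|; last exact: cards1.
  apply: eq_card => j; rewrite !inE.
  have [->|_] := eqVneq j i; first by rewrite id'.
  by have [->|_] := eqVneq j k; rewrite ?(negPf kd) ?andbF.
apply: eq_card0 => j; rewrite !inE; have [->|_] := eqVneq j i.
  by rewrite (negPf iNd').
by have [->|_] := eqVneq j k; rewrite ?(negPf kd') ?andbF.
Qed.

Lemma card_synthemes : #|synthemes| = 15%N.
Proof. by case: doily_GQ22 => _ []. Qed.

Lemma card_duads : #|duads| = 15%N.
Proof. by case: doily_GQ22 => _ []. Qed.

Lemma synthemes_subset s : s \in synthemes -> {subset s <= duads}.
Proof. by rewrite inE => /andP[_ /subsetP]. Qed.

Section Doilies.

Variable N : nat.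
Local Notation V := 'rV['F_2]_(N + N).
Implicit Types (x y z : V) (U : {set V}) (W : {vspace V}).

Definition geometry_of W : {set V} * {set {set V}} := (nz W, lines_in (nz W)).

(** With 16 vectors and a trivial radical, [card_lines_in] becomes 12 L + 60 + 240 = 480. *)
Lemma card_lines4 W : \dim W = 4%N -> #|symp_rad (vset W)| = 1%N ->
  #|lines_in (nz W)| = 15%N.
Proof.
move=> dW; have := card_lines_in (addsub_vset W).
by rewrite card_vset dW nzE => + r1; rewrite r1; lia.
Qed.

Lemma card_nz4 W : \dim W = 4%N -> #|nz W| = 15%N.
Proof.
move=> dW; have := card_vset W; rewrite dW nzE (cardsD1 0).
by rewrite (proj1 (addsub_vset W)) => -[].
Qed.

(** The 15 points exhaust the nonzero vectors of their span, and once the radical is known to be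
    trivial the 15 lines exhaust its totally isotropic lines. *)
Lemma linear_doily_geometry D : D \in linear_doilies N ->
  exists W, [/\ \dim W = 4%N, #|symp_rad (vset W)| = 1%N & D = geometry_of W].
Proof.
case: D => P L; rewrite inE => /andP[]; rewrite inE.
case/andP => /= Pnz /and5P[/eqP P15 Lti /eqP L15 isoD col] /eqP dP.
pose W := <<enum P>>%VS.
have PE : P = nz W.
  apply/eqP; rewrite eqEcard P15 (card_nz4 dP) leqnn andbT.
  apply/subsetP => x xP; rewrite inE (subsetP Pnz) //=.
  by rewrite memv_span // mem_enum.
case/existsP: isoD => f /= /and3P[/forall_inP finj /eqP fP /eqP fL].
have inj d e : d \in duads -> e \in duads -> f d = f e -> d = e.
  by move=> dD eD fde; move/(_ d dD)/forall_inP/(_ e eD): finj; rewrite fde eqxx => /eqP.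
have r1 : #|symp_rad (vset W)| = 1%N.
  have -> : symp_rad (vset W) = [set 0]; last exact: cards1.
  apply/setP => x; rewrite [x \in symp_rad _]inE in_set1.
  apply/andP/eqP => [[xW /forall_inP xrad]|->]; last first.
    by rewrite inE mem0v; split=> //; apply/forall_inP => y _; rewrite symp0x.
  apply/eqP; apply: contraT => x0.
  have : x \in P by rewrite PE nzE !inE x0; rewrite inE in xW.
  rewrite -fP => /imsetP[d dD xE].
  (* A nonzero radical vector would be a point [f d] collinear with every other point. A duad [e]
     meeting [d] in one element contradicts this, since no syntheme contains both. *)
  have /(duad_separation dD) [|e [eD de _]] : ~~ (d \subset set0).
    by rewrite subset0 -cards_eq0; move: dD; rewrite duadE => /eqP->.
  - by rewrite cards0.
  have dNe : d != e.
    by apply: contra_eq_neq de => <-; move: dD; rewrite setIid duadE => /eqP->.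
  have fdP (z : {set 'I_6}) : z \in duads -> f z \in P by move=> zD; rewrite -fP imset_f.
  have /eqP fde : f d != f e by apply: contra dNe => /eqP/(inj _ _ dD eD)->.
  have : collinear (P, L) (f d) (f e).
    move/forall_inP/(_ _ (fdP _ dD))/forall_inP/(_ _ (fdP _ eD)): col.
    move/eqP: fde => -> /eqP <-; rewrite -xE xrad // inE.
    by have := fdP _ eD; rewrite PE !inE => /andP[].
  case/exists_inP => l /=; rewrite -fL => /imsetP[s sS ->].
  have pre (d1 : {set 'I_6}) : d1 \in duads -> f d1 \in f @: s -> d1 \in s.
    by move=> d1D /imsetP[d2 d2s /(inj _ _ d1D)->] //; apply: (synthemes_subset sS).
  case/andP => /(pre _ dD) ds /(pre _ eD) es.
  by have := syntheme_disjoint sS ds es dNe; rewrite -setI_eq0 -cards_eq0 de.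
exists W; split=> //; rewrite /geometry_of -PE; congr pair.
apply/eqP; rewrite eqEcard L15 PE card_lines4 // andbT.
apply/subsetP => l lL; rewrite inE (subsetP Lti) //=.
move: lL; rewrite -fL -PE -fP => /imsetP[s sS ->].
by apply/imsetS/subsetP/synthemes_subset.
Qed.

(** * The duad model inside a symplectic 4-space *)

Section Model.

Variables e1 f1 e2 f2 : V.
Hypotheses (e1f1 : symp e1 f1 = 1) (e2f2 : symp e2 f2 = 1).
Hypotheses (e1e2 : symp e1 e2 = 0) (e1f2 : symp e1 f2 = 0).
Hypotheses (f1e2 : symp f1 e2 = 0) (f1f2 : symp f1 f2 = 0).

(* Five vectors of sum zero with all mutual products 1, preceded by the zero
   vector: the duad {i, j} is sent to the sum of entries i and j. *)
Definition pentad : seq V :=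
  [:: 0; e1; f1; e1 + f1 + e2; e1 + f1 + f2; e1 + f1 + e2 + f2].

Definition duad_vec (d : {set 'I_6}) : V := \sum_(i in d) pentad`_i.

(** The last two terms correct for entry 0, the zero vector, whose products all vanish. *)
Lemma symp_pentad (i j : 'I_6) : symp pentad`_i pentad`_j =
  (i != j)%:R + (i == 0)%:R + (j == 0)%:R.
Proof.
case: i j => [[|[|[|[|[|[|i]]]]]] //] ? [[|[|[|[|[|[|j]]]]]] //] ? /=.
all: rewrite ?sympDr ?sympDl ?sympx0 ?symp0x ?sympxx.
all: rewrite ?(sympC f1 e1) ?(sympC e2) ?(sympC f2).
all: rewrite ?e1f1 ?e1e2 ?e1f2 ?f1e2 ?f1f2 ?(sympC f2) ?e2f2 ?sympxx.
all: by apply: val_inj.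
Qed.

Lemma sum_pentad : \sum_(i < 6) pentad`_i = 0.
Proof.
rewrite !big_ord_recl big_ord0 /=; apply/rowP => i; rewrite !mxE.
by case: (e1 0 i) (f1 0 i) (e2 0 i) (f2 0 i) =>
  [[|[|?]] //] ? [[|[|?]] //] ? [[|[|?]] //] ? [[|[|?]] //] ?; apply: val_inj.
Qed.

(** Summing over the two elements of a duad kills every term constant in that index. Since [i != j]
    is [1 + (i == j)] in F_2, only the coincidences i = j survive. *)
Lemma symp_duad_vec d d' : d \in duads -> d' \in duads ->
  symp (duad_vec d) (duad_vec d') = #|d :&: d'|%:R.
Proof.
rewrite !duadE => /eqP d2 /eqP d'2.
rewrite {1}/duad_vec (big_morph (fun y : V => symp y (duad_vec d'))
  (fun y z => sympDl _ y z) (symp0x _)).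
transitivity (\sum_(i in d) ((i \in d')%:R : 'F_2) +
              \sum_(i in d) \sum_(j in d') ((j == 0)%:R : 'F_2)).
  rewrite -big_split; apply: eq_bigr => i _ /=.
  rewrite (big_morph (symp _) (sympDr _) (sympx0 _)).
  under eq_bigr do rewrite symp_pentad.
  rewrite !big_split /= sumr_const d'2 mulr2n F2_addcc addr0; congr (_ + _).
  transitivity (\sum_(j in d') (1 + (i == j)%:R : 'F_2)).
    by apply: eq_bigr => j _; case: (i == j); apply: val_inj.
  rewrite big_split /= sumr_const d'2 mulr2n F2_addcc add0r.
  rewrite -natr_sum; congr (_%:R); case id' : (i \in d').
    by rewrite (bigD1 i) //= eqxx big1 // => j /andP[_]; rewrite eq_sym => /negPf->.
  by rewrite big1 // => j jd'; case: eqP => // ij; rewrite ij jd' in id'.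
rewrite [X in _ + X]sumr_const d2 mulr2n F2_addcc addr0 -natr_sum.
by rewrite -sum1_card big_mkcond [in RHS]big_mkcond; congr (_%:R);
  apply: eq_bigr => i _; rewrite inE; case: (i \in d).
Qed.

(** Vectors of distinct duads have different products with the vector of the duad supplied by
    [duad_separation]. *)
Lemma duad_vec_inj : {in duads &, injective duad_vec}.
Proof.
move=> d d' dD d'D dd'; apply/eqP; rewrite eqEcard.
move: (dD) (d'D); rewrite !duadE => /eqP-> /eqP d'2; rewrite d'2 leqnn andbT.
apply: contraT => /(duad_separation dD); rewrite d'2 => /(_ isT)[x [xD dx d'x]].
have := symp_duad_vec dD xD; rewrite dx dd' symp_duad_vec // d'x.
by move/(congr1 val).
Qed.

Lemma duad_vec_neq0 d : d \in duads -> duad_vec d != 0.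
Proof.
move=> dD; have /(duad_separation dD) [|x [xD dx _]] : ~~ (d \subset set0).
- by rewrite subset0 -cards_eq0; move: dD; rewrite duadE => /eqP->.
- by rewrite cards0.
have := symp_duad_vec dD xD; rewrite dx; apply: contra_eq_neq => ->.
by rewrite symp0x.
Qed.

(** All six entries sum to zero, so complementary sets have equal sums; hence a syntheme goes to
    three vectors of sum zero. *)
Lemma duad_vecC (d e : {set 'I_6}) : [disjoint d & e] ->
  duad_vec (~: (d :|: e)) = duad_vec d + duad_vec e.
Proof.
move=> de; apply/eqP; rewrite -addv_eq0 -sum_pentad.
have E A : duad_vec A = \sum_i (if i \in A then pentad`_i else 0).
  by rewrite /duad_vec big_mkcond.
rewrite !E -!big_split /=; apply/eqP/eq_bigr => i _.
rewrite !inE; case id : (i \in d); first by rewrite (disjointFr de id) add0r addr0.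
by case: (i \in e); rewrite /= ?add0r ?addr0.
Qed.

Lemma duad_vec_syntheme s : s \in synthemes -> duad_vec @: s \in ti_lines N.
Proof.
move=> sS; have /card_gt0P[d ds] : (0 < #|s|)%N by rewrite (syntheme_card sS).
have /card_gt0P[e] : (0 < #|s :\ d|)%N.
  by have := cardsD1 d s; rewrite (syntheme_card sS) ds; lia.
rewrite !inE => /andP[ed es]; rewrite eq_sym in ed.
have de := syntheme_disjoint sS ds es ed.
have dD := synthemes_subset sS ds; have eD := synthemes_subset sS es.
rewrite (synthemeE sS ds es ed) !imsetU !imset_set1 duad_vecC //.
apply/imsetP; exists (duad_vec d, duad_vec e) => //.
rewrite inE /= !duad_vec_neq0 // symp_duad_vec // (disjoint_setI0 de) cards0 eqxx.
by rewrite andbT; apply: contra ed => /eqP/duad_vec_inj->.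
Qed.

(** For points and for lines alike, the images lie in the geometry of [W], and injectivity with 15
    elements on each side turns inclusion into equality. *)
Lemma duad_vec_isomorphic W : {in [:: e1; f1; e2; f2], forall x, x \in W} ->
  \dim W = 4%N -> #|symp_rad (vset W)| = 1%N -> isomorphic doily (geometry_of W).
Proof.
move=> gW dW r1; have dvW d : duad_vec d \in W.
  have [? ? ? ?] : [/\ e1 \in W, f1 \in W, e2 \in W & f2 \in W].
    by split; apply: gW; rewrite !inE eqxx ?orbT.
  apply: rpred_sum => -[[|[|[|[|[|[|i]]]]]] //] ? _ /=; rewrite ?mem0v //;
  by rewrite !rpredD.
have imP : [ffun d => duad_vec d] @: duads = nz W.
  apply/eqP; rewrite eqEcard (card_nz4 dW) card_in_imset ?card_duads; last first.
    by move=> d d' dD d'D; rewrite !ffunE; apply: duad_vec_inj.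
  rewrite leqnn andbT; apply/subsetP => _ /imsetP[d dD ->].
  by rewrite ffunE !inE dvW duad_vec_neq0.
have imE (s : {set {set 'I_6}}) : [ffun d => duad_vec d] @: s = duad_vec @: s.
  by apply: eq_imset => d; rewrite ffunE.
apply/existsP; exists [ffun d => duad_vec d]; apply/and3P; split => /=.
- apply/forall_inP => d dD; apply/forall_inP => e eD; apply/implyP; rewrite !ffunE.
  by move/eqP/duad_vec_inj->.
- by rewrite imP.
rewrite eqEcard (card_lines4 dW r1) card_in_imset ?card_synthemes; last first.
  have sub s t : s \in synthemes -> t \in synthemes ->
    duad_vec @: s = duad_vec @: t -> s \subset t.
    move=> sS tS st; apply/subsetP => d ds.
    have : duad_vec d \in duad_vec @: t by rewrite -st imset_f.
    case/imsetP => e et /duad_vec_inj-> //; first exact: synthemes_subset ds.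
    exact: synthemes_subset et.
  move=> s t sS tS; rewrite !imE => st.
  by apply/eqP; rewrite eqEsubset !sub.
rewrite leqnn andbT; apply/subsetP => _ /imsetP[s sS ->].
rewrite inE {1}imE duad_vec_syntheme //= -imP.
exact/imsetS/subsetP/synthemes_subset.
Qed.

End Model.

(** * Counting linear doilies by symplectic bases *)

Definition seq4 (t : (V * V) * (V * V)) := [:: t.1.1; t.1.2; t.2.1; t.2.2].

Lemma hyp_hypP U e1 f1 e2 f2 : (e1, f1, (e2, f2)) \in hyp_hyp U ->
  [/\ symp e1 f1 = 1, symp e2 f2 = 1, symp e1 e2 = 0 & symp e1 f2 = 0] /\
  [/\ symp f1 e2 = 0, symp f1 f2 = 0 &
    {in seq4 (e1, f1, (e2, f2)), forall x, x \in U}].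
Proof.
rewrite inE => /andP[/hypP[e1U f1U ef1] /hypP[]]; rewrite !inE /=.
case/and3P => e2U /eqP e12 /eqP fe12 /and3P[f2U /eqP ef12 /eqP f12] ef2.
by do !split=> //; move=> x; rewrite !inE => /or4P[] /eqP->.
Qed.

Lemma free_seq4 U t : t \in hyp_hyp U -> free (seq4 t).
Proof.
case: t => [[e1 f1] [e2 f2]] /hyp_hypP[[ef1 ef2 e12 ef12] [fe12 f12 _]].
rewrite !free_cons nil_free span_nil memv0 /= andbT.
have f20 : f2 != 0 by apply: contra_eq_neq ef2 => ->; rewrite sympx0.
apply/and4P; split=> //; [apply: (@hyp_notin _ _ f1) | apply: (@hyp_notin _ _ e1)
  | apply: (@hyp_notin _ _ f2)]; rewrite ?(sympC _ e1) ?(sympC f2) //.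
- by move=> y; rewrite !inE => /or3P[] /eqP->; rewrite ?sympxx.
- by move=> y; rewrite !inE => /orP[] /eqP->.
- by move=> y; rewrite !inE => /eqP->; rewrite sympxx.
Qed.

(** Splitting off both pairs cuts 16 vectors to 4 and then to 1 without changing the radical. *)
Lemma rad_hyp_hyp W t : t \in hyp_hyp (vset W) -> \dim W = 4%N ->
  #|symp_rad (vset W)| = 1%N.
Proof.
case: t => p q; have WA := addsub_vset W.
rewrite inE => /andP[/= pW qP] dW; have PA := addsub_perp p WA.
have := card_perp PA qP; have := card_perp WA pW.
rewrite card_vset dW -(rad_perp WA pW) -(rad_perp PA qP).
set Q := perp _ q => P4 Q4; have Q1 : #|Q| = 1%N by lia.
apply/eqP; rewrite eqn_leq; apply/andP; split.
  apply: (@leq_trans #|Q|); last by rewrite Q1.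
  by apply: subset_leq_card; apply/subsetP => x; rewrite inE => /andP[].
apply/card_gt0P; exists (0 : V); rewrite inE (proj1 (addsub_perp q PA)).
by apply/forall_inP => y _; rewrite symp0x.
Qed.

Lemma geometry_linear_doily W t : t \in hyp_hyp (vset W) -> \dim W = 4%N ->
  geometry_of W \in linear_doilies N.
Proof.
move=> tW dW; have r1 := rad_hyp_hyp tW dW.
rewrite inE /= span_nz dW eqxx andbT inE /=.
apply/andP; split; first by apply/subsetP => x; rewrite inE => /andP[].
apply/and5P; split; rewrite ?(card_nz4 dW) ?(card_lines4 dW r1) //.
- by apply/subsetP => l; rewrite inE => /andP[].
- case: t tW => [[e1 f1] [e2 f2]] /hyp_hypP[[? ? ? ?] [? ? gW]].
  apply: (@duad_vec_isomorphic e1 f1 e2 f2) => // x /gW; by rewrite inE.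
apply/forall_inP => a aW; apply/forall_inP => b bW; apply/implyP => ab; apply/eqP.
apply/idP/exists_inP => /= [ab0|[l]]; last first.
  by rewrite inE => /andP[lL _] /andP[al bl]; have [->] := ti_line_eq lL al bl ab.
exists [set a; b; a + b]; last by rewrite !inE !eqxx orbT.
move: aW bW; rewrite !inE => /andP[a0 aW] /andP[b0 bW]; apply/andP; split.
  by apply/imsetP; exists (a, b); rewrite ?inE /= ?a0 ?b0 ?ab.
apply/subsetP => x; rewrite !inE -orbA => /or3P[] /eqP->; rewrite ?a0 ?b0 //.
by rewrite addv_eq0 ab rpredD.
Qed.

(** By [linear_doily_geometry] a linear doily amounts to a nondegenerate 4-space, whose symplectic
    bases number 720, the order of Sp(4,2). *)
Lemma card_linear_doilies : #|hyp_hyp [set: V]| = (#|linear_doilies N| * 720)%N.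
Proof.
apply: (@card_fibres _ _ (fun t => geometry_of <<seq4 t>>)) => [t tT|D].
  have ft := free_seq4 tT; have d4 : \dim <<seq4 t>> = 4%N by apply/eqP.
  apply: (@geometry_linear_doily _ t) => //.
  have tin x : x \in seq4 t -> x \in <<seq4 t>>%VS by apply: memv_span.
  move: tT; rewrite !inE /=.
  by rewrite !tin // !inE eqxx ?orbT.
case/linear_doily_geometry => W [dW r1 ->].
have W16 : #|vset W| = (4 * 4)%N by rewrite card_vset dW.
have := card_hyp_hyp (addsub_vset W) W16; rewrite W16 r1 => h720.
(* Here 4 * 720 = (16 - 1) * 16 * ((4 - 1) * 4). *)
have <- : #|hyp_hyp (vset W)| = 720%N by lia.
apply: eq_card => t; rewrite [LHS]inE; apply/andP/idP => [[tT /eqP [tW _]]|tW].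
  have tn x : x \in seq4 t -> x \in W.
    by move/(mem_nz_span (free_seq4 tT)); rewrite tW !inE => /andP[].
  by move: tT; rewrite !inE /= !tn // !inE eqxx ?orbT.
rewrite /geometry_of (@nz_span_subset _ W) ?dW ?(free_seq4 tW) //; last first.
  by case: t tW => [[? ?] [? ?]] /hyp_hypP[_ [_ _]].
by split=> //; move: tW; rewrite !inE /= => /andP[/and3P[_ _ ->]]
  /and3P[/and3P[_ -> ->] /and3P[_ -> ->] ->].
Qed.

End Doilies.

(** * Evaluation of the closed formulas *)

Lemma Theta2E n : let q : rat := 2 ^+ n in
  Theta2 n.+2 = q ^+ 2 * (4 * q ^+ 2 - 1) * (16 * q ^+ 2 - 1) / 3.
Proof.
move=> q; rewrite /Theta2 big_ltn // big_ltn // big_geq //.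
rewrite [X in _ * X]big_ltn // [X in _ * (_ * X)]big_ltn // big_geq //.
have -> : (n.+2 - 2 + 1 = n + 1)%N by lia.
have -> : (n.+2 - 2 + 2 = n + 2)%N by lia.
have -> : (n.+2 + 1 - 1 = n + 2)%N by lia.
have -> : (n.+2 + 1 - 2 = n + 1)%N by lia.
have -> : (2 * n.+2 = n + n + 4)%N by lia.
(* The factors pair up as (2q - 1)(2q + 1) and (4q - 1)(4q + 1); the 3 is the denominator at i =
   2. *)
by rewrite !exprD -/q; field.
Qed.

(** The exponent is an integer because it equals -1 in the smallest case, two qubits. *)
Lemma expr4_shift n : 4 ^ (n.+2%:Z - 3) = (2 ^+ n) ^+ 2 / 4 :> rat.
Proof.
have -> : n.+2%:Z - 3 = n%:Z - 1 by lia.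
by rewrite expfzDr // exprN1 -exprM mulnC exprM.
Qed.

(** With N = n + 2, [k] is the number of vectors orthogonal to a hyperbolic pair of the whole space.
    The two equations give 60 L = k P, and k / 60 is the factor in front of [Theta2]. *)
Lemma count_formulas n (P L : nat) (k := (4 ^ n.+1)%N) :
    (2 * (P * 24) = (4 * k - 1) * (4 * k) * (k - 1))%N ->
    (4 * (L * 720) = (4 * k - 1) * (4 * k) * ((k - 1) * k))%N ->
  P%:R = Theta2 n.+2 /\ L%:R = 4 / 15 * 4 ^ (n.+2%:Z - 3) * Theta2 n.+2.
Proof.
rewrite Theta2E expr4_shift; set q : rat := 2 ^+ n.
(* Positivity of [k] lets the natural subtractions be cast to the rationals by [natrB]. *)
have k0 : (0 < k)%N by rewrite expn_gt0.
have kE : k%:R = 4 * q ^+ 2 :> rat.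
  by rewrite natrX exprS -exprM mulnC exprM.
move=> /(congr1 (fun m => m%:R : rat)) PE /(congr1 (fun m => m%:R : rat)) LE.
move: PE LE; rewrite !natrM !natrB ?muln_gt0 ?k0 // !natrM kE => PE LE.
by split; lra.
Qed.

Theorem mainTheorem3 (N : nat) (hN : (2 <= N)%N) :
  #|[set A in pg_planes N |
       #|[set l in ti_lines N | l \subset A]| == 3%N]|%:R = Theta2 N
  /\ #|linear_doilies N|%:R
       = 4 / 15 * 4 ^ (N%:Z - 3) * Theta2 N.
Proof.
change (#|planes3 N|%:R = Theta2 N /\ #|linear_doilies N|%:R
       = 4 / 15 * 4 ^ (N%:Z - 3) * Theta2 N).
case: N hN => [|[|n]] // _.
have cV : #|[set: 'rV['F_2]_(n.+2 + n.+2)]| = (4 * 4 ^ n.+1)%N.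
  by rewrite cardsT card_mx mul1n card_ord addnn -mul2n expnM expnS.
have r1 : #|symp_rad [set: 'rV['F_2]_(n.+2 + n.+2)]| = 1%N.
  by rewrite rad_setT cards1.
apply: count_formulas.
  by rewrite -card_planes3 (card_hyp_rad (addsub_setT _) cV) cV r1.
by rewrite -card_linear_doilies (card_hyp_hyp (addsub_setT _) cV) cV r1.
Qed.
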